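(* Let $\mathcal{C}$ be a closed, pointed, convex cone in a finite-dimensional real vector space, and let $\mathcal{H}(\mathcal{C})$ be the height of the poset of faces of $\mathcal{C}$. If $\mathcal{C}$ is $(\mathcal{H}(\mathcal{C})-1)$-Terracini convex, then $\mathcal{C}$ is Terracini convex.
   Context: A convex cone $\mathcal{C}$ is pointed if $\mathcal{C}\cap(-\mathcal{C})=\{0\}$. A nonempty convex subcone $\mathcal{F}\subseteq\mathcal{C}$ is a face if $x,y\in\mathcal{C}$ and $x+y\in\mathcal{F}$ imply $x,y\in\mathcal{F}$ (the empty set is not a face; $\{0\}$ and $\mathcal{C}$ are faces). The height $\mathcal{H}(\mathcal{C})$ is the maximal number $m$ of faces in a chain of faces $\mathcal{F}^{(1)}\subsetneq\cdots\subsetneq\mathcal{F}^{(m)}$ of $\mathcal{C}$. For $x\in\mathcal{C}$, let $\mathcal{T}_{\mathcal{C}}(x)=\overline{\mathrm{cone}\{z-x:z\in\mathcal{C}\}}$ be the tangent cone and $\mathcal{L}_{\mathcal{C}}(x)=\mathcal{T}_{\mathcal{C}}(x)\cap(-\mathcal{T}_{\mathcal{C}}(x))$ the convex tangent space. $\mathcal{C}$ is $k$-Terracini convex if $\mathcal{L}_{\mathcal{C}}\big(\sum_{i=1}^kx^{(i)}\big)=\sum_{i=1}^k\mathcal{L}_{\mathcal{C}}(x^{(i)})$ for any collection $x^{(1)},\ldots,x^{(k)}$ of (not necessarily distinct) generators of extreme rays of $\mathcal{C}$; it is Terracini convex if it is $k$-Terracini convex for all $k$. *)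

(* Defs.v *)
From HB Require Import structures.
From mathcomp Require Import all_boot all_order all_algebra.
From mathcomp Require Import all_classical all_reals all_analysis.

Set Implicit Arguments.
Unset Strict Implicit.
Unset Printing Implicit Defensive.

Import Order.TTheory GRing.Theory Num.Theory.
Import numFieldNormedType.Exports.

Local Open Scope classical_set_scope.
Local Open Scope ring_scope.

(* Every finite-dimensional real vector space carries exactly one Hausdorff
   linear topology, and any norm induces it: the norm below only serves to
   give access to [closed] and [closure], none of the notions defined in this
   file depends on which norm is chosen. *)
#[short(type="normedVectType")]
HB.structure Definition NormedVector (R : realType) :=
  {V of NormedModule R V & Vector R V}.

HB.instance Definition _ (R : realType) (m n : nat) :=
  Vector.on 'M[R]_(m.+1, n.+1).

Section TerraciniConvexity.
Context (R : realType) (V : normedModType R).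
Implicit Types (C F S : set V) (x v : V) (k m : nat).

Definition minkowski_sum k (L : 'I_k -> set V) : set V :=
  [set v | exists2 f : 'I_k -> V, (forall i, L i (f i)) & v = \sum_i f i].

Definition cone_hull S : set V :=
  [set v | exists n (a : 'I_n -> R) (s : 'I_n -> V),
    [/\ forall i, 0 <= a i, forall i, S (s i) & v = \sum_i a i *: s i]].

(* Scaling is by nonnegative reals, so that a nonempty cone contains 0; the
   empty set qualifies, nonemptiness being required where it is needed. *)
Definition convex_cone C : Prop :=
  convex_set C /\ forall (a : R) x, 0 <= a -> C x -> C (a *: x).

(* Rules out the empty set. *)
Definition pointed_cone C : Prop := C `&` (-%R @` C) = [set 0].

Definition face C F : Prop :=
  [/\ F !=set0, convex_cone F, F `<=` C &
      forall x y, C x -> C y -> F (x + y) -> F x /\ F y].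

Definition face_chain C m : Prop :=
  exists F : 'I_m -> set V,
    (forall i, face C (F i)) /\ (forall i j : 'I_m, (i < j)%N -> F i `<` F j).

(* The maximal length of a chain of faces; the default 0 is for cones that
   admit arbitrarily long chains, which needs infinite dimension. *)
Definition height C : nat :=
  xget 0%N [set m | face_chain C m /\
                    forall m', face_chain C m' -> (m' <= m)%N].

Definition tangent_cone C x : set V :=
  closure (cone_hull [set z - x | z in C]).

Definition convex_tangent_space C x : set V :=
  tangent_cone C x `&` (-%R @` tangent_cone C x).

Definition extreme_ray_generator C x : Prop :=
  x != 0 /\ face C [set a *: x | a in [set a : R | 0 <= a]].

Definition terracini_convex_at k C : Prop :=
  forall x : 'I_k -> V, (forall i, extreme_ray_generator C (x i)) ->
    convex_tangent_space C (\sum_i x i) =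
    minkowski_sum (fun i => convex_tangent_space C (x i)).

Definition terracini_convex C : Prop := forall k, terracini_convex_at k C.

End TerraciniConvexity.

(* Main.v *)
(** The tangent cone at [x] only grows when [x] is replaced by a [y] whose
    minimal face contains [x]. Adding generators one at a time, each outside
    the minimal face of the current sum as long as this is possible, produces a
    strictly increasing chain of faces that starts at [{0}]; hence some
    [height C - 1] of the given generators, with repetitions, have a sum [y]
    whose minimal face contains all of them. Then the convex tangent space at
    the full sum is contained in the one at [y], which the hypothesis splits.
    The height is a genuine maximum because a face [F] of [C] satisfies
    [F = C `&` span F], so that dimensions increase strictly along a chain. *)
Require Import Defs.
From mathcomp Require Import all_boot all_order all_algebra.
From mathcomp Require Import all_classical all_reals all_analysis.
From mathcomp Require Import ring lra.

Import Order.TTheory GRing.Theory Num.Theory.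

Local Open Scope classical_set_scope.
Local Open Scope ring_scope.

(** * Convex cones and minimal faces *)

Section ConvexCones.
Context {R : realType} {V : normedModType R}.
Implicit Types (C F S : set V) (x y v : V).

Lemma convex_coneP C : convex_cone C <->
  (forall x y, C x -> C y -> C (x + y)) /\
  (forall (a : R) x, 0 <= a -> C x -> C (a *: x)).
Proof.
split=> [[Cconv Cscale]|[Cadd Cscale]]; split=> //.
- move=> x y Cx Cy.
  have half_ge0 : (0 : R) <= 2^-1 by lra.
  have half_le1 : (2^-1 : R) <= 1 by lra.
  have /set_mem := Cconv x y (Itv01 half_ge0 half_le1) (mem_set Cx)
    (mem_set Cy).
  rewrite /conv /= => /(Cscale 2 _ (ler0n _ _)).
  rewrite (_ : unstable.onem 2^-1 = 2^-1); last first.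
    by rewrite /unstable.onem; field.
  by rewrite -scalerDr scalerA divff ?pnatr_eq0 // scale1r.
- move=> x y l /set_mem Cx /set_mem Cy; apply/mem_set.
  by rewrite /conv /=; apply: Cadd; apply: Cscale => //; rewrite subr_ge0.
Qed.

Lemma convex_cone0 C : C !=set0 -> convex_cone C -> C 0.
Proof. by move=> [x Cx] [_ /(_ 0 x (lexx _) Cx)]; rewrite scale0r. Qed.

Lemma convex_cone_sum C I (r : seq I) (f : I -> V) :
  C 0 -> convex_cone C -> (forall i, C (f i)) -> C (\sum_(i <- r) f i).
Proof.
move=> C0 /convex_coneP[Cadd _] Cf.
by apply: (big_ind C) => // x y; apply: Cadd.
Qed.

(** For a convex cone [C] and [y] in [C], this is the smallest face containing [y]: a face with [y]
    contains [c *: y], hence both summands [x] and [c *: y - x]. *)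
Definition face_of C y : set V :=
  [set x | C x /\ exists2 c : R, 0 <= c & C (c *: y - x)].

Lemma face_of_face C y : convex_cone C -> C y -> face C (face_of C y).
Proof.
move=> Ccone Cy; have C0 : C 0 by apply: convex_cone0 => //; exists y.
have /convex_coneP[Cadd Cscale] := Ccone; split.
- by exists y; split=> //; exists 1; rewrite ?ler01 // scale1r subrr.
- apply/convex_coneP; split.
    move=> u v [Cu [c c0 Cc]] [Cv [d d0 Cd]]; split; first exact: Cadd.
    exists (c + d); first exact: addr_ge0.
    by rewrite scalerDl opprD addrACA; exact: Cadd.
  move=> a u a0 [Cu [c c0 Cc]]; split; first exact: Cscale.
  exists (a * c); first exact: mulr_ge0.
  by rewrite -scalerA -scalerBr; exact: Cscale.
- by move=> u [].
- move=> u v Cu Cv [_ [c c0 Cc]]; split; split=> //; exists c => //.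
    by have := Cadd _ _ Cc Cv; rewrite opprD addrA subrK.
  by have := Cadd _ _ Cc Cu; rewrite (addrC u) opprD addrA subrK.
Qed.

Lemma face_of_addl C x y : convex_cone C -> C x -> C y ->
  face_of C y `<=` face_of C (x + y).
Proof.
move=> /convex_coneP[Cadd Cscale] Cx Cy v [Cv [c c0 Cc]]; split=> //.
by exists c => //; rewrite scalerDr -addrA; apply: Cadd => //; apply: Cscale.
Qed.

Lemma face_of_add C x y : C x -> C y -> face_of C (x + y) x.
Proof.
by move=> Cx Cy; split=> //; exists 1 => //; rewrite scale1r addrC addKr.
Qed.

Lemma extreme_ray_generator_mem C x : extreme_ray_generator C x -> C x.
Proof. by case=> _ [_ _ + _]; apply; exists 1; rewrite /= ?ler01 ?scale1r. Qed.

(** * Tangent cones and convex tangent spaces *)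

Lemma cone_hullD S x y : cone_hull S x -> cone_hull S y -> cone_hull S (x + y).
Proof.
move=> [m [a [s [a0 Ss ->]]]] [n [b [t [b0 St ->]]]]; exists (m + n)%N.
exists (fun i => match fintype.split i with inl j => a j | inr j => b j end).
exists (fun i => match fintype.split i with inl j => s j | inr j => t j end).
split=> [i|i|]; [by case: fintype.split | by case: fintype.split | ].
rewrite big_split_ord /=; congr (_ + _); apply: eq_bigr => i _.
  by rewrite (unsplitK (inl i)).
by rewrite (unsplitK (inr i)).
Qed.

Lemma cone_hull0 S : cone_hull S 0.
Proof.
by exists 0%N, (fun=> 0), (fun=> 0); split=> [[]|[]|]; rewrite ?big_ord0.
Qed.

Lemma closureD S : (forall x y, S x -> S y -> S (x + y)) ->
  forall x y, closure S x -> closure S y -> closure S (x + y).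
Proof.
move=> Sadd x y Sx Sy B /(@add_continuous V (x, y))[[U W] /= [Ux Wy] UWB].
have [u [Su Uu]] := Sx U Ux; have [w [Sw Ww]] := Sy W Wy.
by exists (u + w); split; [exact: Sadd | exact: (UWB (u, w))].
Qed.

Lemma convex_tangent_spaceD C x u v :
  convex_tangent_space C x u -> convex_tangent_space C x v ->
  convex_tangent_space C x (u + v).
Proof.
have TD := closureD _ (cone_hullD [set z - x | z in C]).
move=> [Tu [u' Tu' uE]] [Tv [v' Tv' vE]]; split; first exact: TD.
by exists (u' + v'); [exact: TD | rewrite opprD uE vE].
Qed.

Lemma convex_tangent_space0 C x : convex_tangent_space C x 0.
Proof.
have T0 : tangent_cone C x 0 by apply: subset_closure; exact: cone_hull0.
by split=> //; exists 0; rewrite ?oppr0.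
Qed.

Lemma convex_tangent_space_sum C x I (r : seq I) (P : pred I) (f : I -> V) :
  (forall i, P i -> convex_tangent_space C x (f i)) ->
  convex_tangent_space C x (\sum_(i <- r | P i) f i).
Proof.
apply: big_ind; first exact: convex_tangent_space0.
by move=> u v; apply: convex_tangent_spaceD.
Qed.

(** For [z] in [C], the vector [z - x] equals [(z + (c *: y - x) + y) - (c + 1) *: y], so it is
    [c + 1] times a generating direction at [y]. The extra [y] makes the factor invertible even if
    [c] is 0. *)
Lemma subset_tangent_cone C x y : convex_cone C -> C y -> face_of C y x ->
  tangent_cone C x `<=` tangent_cone C y.
Proof.
move=> /convex_coneP[Cadd Cscale] Cy [Cx [c c0 Cc]].
apply: closureS => _ [n [a [s [a0 Ss ->]]]].
have d0 : 0 < c + 1 by apply: ltr_wpDl.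
exists n, (fun i => a i * (c + 1)), (fun i => (c + 1)^-1 *: s i).
split=> [i|i|].
- by rewrite mulr_ge0 // ltW.
- have [z Cz <-] := Ss i; exists ((c + 1)^-1 *: (z + (c *: y - x) + y)).
    apply: Cscale; first by rewrite invr_ge0 ltW.
    by apply: (Cadd _ _ _ Cy); exact: Cadd.
  have {3}-> : y = (c + 1)^-1 *: (c *: y + y).
    by rewrite -{3}[y]scale1r -scalerDl scalerA mulVf ?scale1r ?lt0r_neq0.
  rewrite -scalerBr; congr (_ *: _).
  by rewrite opprD addrACA subrr addr0 addrAC addrA subrK.
- by apply: eq_bigr => i _; rewrite scalerA mulfK ?lt0r_neq0.
Qed.

Lemma subset_convex_tangent_space C x y : convex_cone C -> C y ->
  face_of C y x -> convex_tangent_space C x `<=` convex_tangent_space C y.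
Proof.
move=> Ccone Cy yx; have TT := subset_tangent_cone _ _ _ Ccone Cy yx.
by move=> u [/TT Tu [v /TT Tv vu]]; split=> //; exists v.
Qed.

Lemma pointed_convex_tangent_space0 C : closed C -> convex_cone C ->
  pointed_cone C -> convex_tangent_space C 0 = [set 0].
Proof.
move=> Cclosed Ccone Cpointed.
have [C0 _] : (C `&` (-%R @` C)) 0 by rewrite Cpointed.
have /convex_coneP[_ Cscale] := Ccone.
have TC : tangent_cone C 0 `<=` C.
  rewrite [X in _ `<=` X](iffLR (closure_id C) Cclosed).
  apply: closureS => _ [n [a [s [a0 Ss ->]]]].
  apply: convex_cone_sum => // i; apply: Cscale => //.
  by have [z Cz <-] := Ss i; rewrite subr0.
apply/seteqP; split=> [u [/TC Cu [v /TC Cv vu]]|_ ->].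
  by rewrite -Cpointed; split=> //; exists v.
exact: convex_tangent_space0.
Qed.

(** Terms with the same image under [f] are grouped; an index that [f] misses receives the empty sum
    0. *)
Lemma minkowski_sum_reindex k m (L : 'I_k -> set V) (f : 'I_m -> 'I_k) :
  (forall i, L i 0) -> (forall i u v, L i u -> L i v -> L i (u + v)) ->
  minkowski_sum (fun j => L (f j)) `<=` minkowski_sum L.
Proof.
move=> L0 LD v [w Lw ->]; exists (fun i => \sum_(j | f j == i) w j).
  move=> i; apply: (big_ind (L i)) => // [u u'|j /eqP <- //]; exact: LD.
by rewrite (partition_big f predT).
Qed.

(** The inclusion valid in every convex cone: each [x i] lies in the minimal face of the total
    sum. *)
Lemma minkowski_sum_convex_tangent_space C k (x : 'I_k -> V) :
  convex_cone C -> (forall i, C (x i)) ->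
  minkowski_sum (fun i => convex_tangent_space C (x i)) `<=`
  convex_tangent_space C (\sum_i x i).
Proof.
move=> Ccone Cx _ [w Lw ->]; apply: convex_tangent_space_sum => i _.
have C0 : C 0 by apply: convex_cone0 => //; exists (x i).
have Crest : C (\sum_(j | j != i) x j).
  by rewrite -big_filter; apply: convex_cone_sum.
move: (Lw i); apply: subset_convex_tangent_space => //.
  exact: convex_cone_sum.
by rewrite (bigD1 i) //=; apply: face_of_add.
Qed.

End ConvexCones.

(** * Chains of faces in finite dimension *)

Section Height.
Context {R : realType} {V : normedVectType R}.
Implicit Types (C F : set V) (x y v : V).

(** If [v] has coordinates [a i], adding the combination with coefficients [|a i|], itself in [F],
    makes all coefficients nonnegative. The sum is then in [F], and the face property returns
    [v]. *)
Lemma face_span C F (s : seq V) v : convex_cone C -> face C F ->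
  (forall x, x \in s -> F x) -> C v -> v \in span s -> F v.
Proof.
move=> Ccone [F0 Fcone FC Fface] sF Cv /(@coord_span _ _ _ (in_tuple s)) vE.
have F00 := convex_cone0 _ F0 Fcone.
have /convex_coneP[_ Fscale] := Fcone.
pose a i := coord (in_tuple s) i v.
have Fs (i : 'I_(size s)) : F s`_i by apply: sF; exact: mem_nth.
have Fabs : F (\sum_i `|a i| *: s`_i).
  by apply: convex_cone_sum => // i; apply: Fscale.
have Fv : F (v + \sum_i `|a i| *: s`_i).
  rewrite {1}vE -big_split /=; apply: convex_cone_sum => // i.
  rewrite -scalerDl; apply: Fscale => //.
  by rewrite -lerBlDl sub0r -normrN ler_norm.
by case: (Fface _ _ Cv (FC _ Fabs) Fv).
Qed.

(** By [face_span], a vector of [F m.+1] outside [F m] is independent of the vectors found in [F m].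
    The bottom face may be [{0}] and contributes none, so [m.+1] faces give [m] vectors. *)
Lemma face_chain_free C m (F : nat -> set V) : convex_cone C ->
  (forall n, (n <= m)%N -> face C (F n)) ->
  (forall n, (n < m)%N -> F n `<` F n.+1) ->
  exists s : seq V, [/\ free s, size s = m & forall x, x \in s -> F m x].
Proof.
move=> Ccone; elim: m => [|m IHm] Fface Fprop.
  by exists [::]; split=> //; exact: nil_free.
have [n nm|n nm|s [sfree ssize sF]] := IHm; first by apply: Fface; exact: leqW.
  by apply: Fprop; exact: leqW.
have [FF /existsNP[v /not_implyP[Fv nFv]]] := Fprop m (ltnSn m).
exists (v :: s); split=> [||x].
- rewrite free_cons sfree andbT; apply/negP => vs; apply: nFv.
  apply: (face_span C) vs => //; first exact: Fface.
  by have [_ _ + _] := Fface _ (leqnn m.+1); apply.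
- by rewrite /= ssize.
- by rewrite inE => /orP[/eqP -> //|/sF]; exact: FF.
Qed.

Lemma face_chain_leq_dim C m : convex_cone C -> face_chain C m ->
  (m <= (\dim {:V}).+1)%N.
Proof.
move=> Ccone; case: m => // m [F [Fface Fprop]].
have [//|n nm|s [/eqP sfree ssize _]] :=
  face_chain_free C m (fun n => F (inord n)) Ccone.
  by apply: Fprop; rewrite !inordK // ltnW.
by rewrite ltnS -ssize -sfree; apply: dimvS; exact: subvf.
Qed.

Lemma face_chain_leq_height C m : convex_cone C -> face_chain C m ->
  (m <= height C)%N.
Proof.
move=> Ccone.
(* The empty chain and the dimension bound yield a maximal length, so [xget] returns a true maximum
   and not its default. *)
have ex : exists m, `[< face_chain C m >].
  by exists 0%N; apply/asboolP; exists (fun=> set0); split=> [[]|[]].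
have ub n : `[< face_chain C n >] -> (n <= (\dim {:V}).+1)%N.
  by move=> /asboolP; exact: face_chain_leq_dim.
have [h /asboolP hchain hmax] := ex_maxnP ex ub.
have [_ +] : face_chain C (height C) /\
    forall m', face_chain C m' -> (m' <= height C)%N.
  apply: (@xgetPex _ 0%N [set m | face_chain C m /\
    forall m', face_chain C m' -> (m' <= m)%N]).
  by exists h; split=> // n /asboolP; exact: hmax.
exact.
Qed.

Lemma face_of_sum_height C k (x : 'I_k -> V) : (0 < k)%N -> convex_cone C ->
  (forall i, C (x i)) ->
  exists s : seq 'I_k, size s = (height C - 1)%N /\
    forall i, face_of C (\sum_(j <- s) x j) (x i).
Proof.
move=> k0 Ccone Cx; pose i0 := Ordinal k0.
have C0 : C 0 by apply: convex_cone0 => //; exists (x i0).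
pose covers y := forall i, face_of C y (x i).
(* [pick y] is an index not yet covered by the minimal face of [y], if there is one. Otherwise it is
   arbitrary and merely pads the list to its prescribed length. *)
have [pick pickP] : {pick : V -> 'I_k & forall y, ~ covers y ->
    ~ face_of C y (x (pick y))}.
  apply: (@choice _ _ (fun y j => ~ covers y -> ~ face_of C y (x j))) => y.
  have [cy|/existsNP[i ni]] := pselect (covers y); first by exists i0.
  by exists i.
pose s n := iter n (fun s => pick (\sum_(j <- s) x j) :: s) [::].
pose y n := \sum_(j <- s n) x j.
have yS n : y n.+1 = x (pick (y n)) + y n by rewrite /y /= big_cons.
have Cy n : C (y n) by exact: convex_cone_sum.
have yle n m : (n <= m)%N -> face_of C (y n) `<=` face_of C (y m).
  move=> /subnK <-; elim: (m - n)%N => // d IHd; rewrite addSn yS.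
  by apply: (subset_trans IHd); exact: face_of_addl.
pose h := (height C - 1)%N.
have ssize n : size (s n) = n by elim: n => //= n ->.
exists (s h); split; first exact: ssize.
(* If [y h] fails to cover, so does every earlier [y n], and the minimal faces of [y 0, ..., y h.+1]
   increase strictly. *)
apply: contrapT => ncov.
have ncov_le n : (n <= h)%N -> ~ covers (y n).
  by move=> nh cn; apply: ncov => i; apply: (yle n).
have chain : face_chain C h.+2.
  exists (fun i => face_of C (y i)); split=> [i|i j ij].
    exact: face_of_face.
  split; first by apply: yle; exact: ltnW.
  have ih : (i <= h)%N by rewrite -ltnS; apply: leq_trans ij _; rewrite -ltnS.
  move=> ji; apply: (pickP (y i)); first exact: ncov_le.
  by apply: ji; apply: (yle i.+1) => //; rewrite yS; exact: face_of_add.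
(* [h.+2] exceeds [height C] even when [height C] is 0 and the subtraction in [h] truncates. *)
have := face_chain_leq_height _ _ Ccone chain.
by rewrite /h; case: (height C) => [|n] //=; rewrite subn1 /= ltnn.
Qed.

End Height.

Theorem proposition2p2 (R : realType) (V : normedVectType R) (C : set V)
    (C_closed : closed C) (C_cone : convex_cone C) (C_pointed : pointed_cone C)
    (C_terracini : terracini_convex_at (height C - 1)%N C) :
  terracini_convex C.
Proof.
move=> k x xgen; have Cx i := extreme_ray_generator_mem _ _ (xgen i).
apply/seteqP; split; last exact: minkowski_sum_convex_tangent_space.
(* The empty family offers no generator to repeat; there both sides are [{0}], as [C] is closed and
   pointed. *)
case: k x xgen Cx => [|k] x xgen Cx.
  rewrite big_ord0 pointed_convex_tangent_space0 // => _ ->.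
  by exists (fun=> 0) => [[]//|]; rewrite big_ord0.
have [s [ssize scov]] := face_of_sum_height _ _ x (ltn0Sn k) C_cone Cx.
have C0 : C 0 by apply: convex_cone0 => //; exists (x ord0).
have Cy : C (\sum_(j <- s) x j) by exact: convex_cone_sum.
have ycov : face_of C (\sum_(j <- s) x j) (\sum_i x i).
  have [F0 Fcone _ _] := face_of_face _ _ C_cone Cy.
  by apply: convex_cone_sum => //; exact: convex_cone0.
apply: (subset_trans (subset_convex_tangent_space _ _ _ C_cone Cy ycov)).
(* The sum over the list becomes one over [size s] ordinals, to which the hypothesis applies;
   repeated indices are regrouped afterwards. *)
rewrite (big_nth ord0) big_mkord; rewrite -ssize in C_terracini.
rewrite C_terracini => [|j]; last exact: xgen.
apply: (minkowski_sum_reindex _ _ (fun i => convex_tangent_space C (x i))).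
  by move=> i; exact: convex_tangent_space0.
by move=> i u v; exact: convex_tangent_spaceD.
Qed.
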